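(* Let $d\geq 2$ and $\omega\in C^1(\mathbb{R}^d,\mathbb{R})$ be such that $\omega(0)=0$, $\nabla\omega(0)=0$, $\omega(v)>0$ for all $v\neq 0$ and $\nabla\omega(v)\neq 0$ for all $v\neq 0$. Assume also that, for all $a\in\mathbb{R}$, the set $\omega^{-1}(\{a\})$ is connected. Let $g\in C^1(\mathbb{R}^d,\mathbb{R})$ be such that, for all $(v',v'')\in(\mathbb{R}^d)^2$, $$\omega(v')+\omega(v'')=\omega(v'+v'')\quad\Rightarrow\quad g(v')+g(v'')=g(v'+v'').$$ Then there exist $b\in\mathbb{R}^d$ and $c\in\mathbb{R}$ such that, for all $v\in\mathbb{R}^d$, $$g(v)=b\cdot v+c\,\omega(v).$$
   Context: The empty set is regarded as connected. *)

(* Defs.v *)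
From mathcomp Require Import all_boot all_order all_algebra.
From mathcomp Require Import all_classical all_reals all_analysis.

Set Implicit Arguments.
Unset Strict Implicit.
Unset Printing Implicit Defensive.

Import Order.TTheory GRing.Theory Num.Theory.
Import numFieldNormedType.Exports.

Local Open Scope classical_set_scope.
Local Open Scope ring_scope.

(* R^d is 'rV[R]_d; its library norm is the sup norm, which induces the usual
   topology and the usual notion of differentiability. *)

Definition dotprod (R : realType) (d : nat) (u v : 'rV[R]_d) : R :=
  \sum_(i < d) u 0 i * v 0 i.

(* 'D_v f x is total (junk where f is not derivable), so this is meaningful
   only where the partial derivatives of f exist. *)
Definition gradient (R : realType) (d : nat) (f : 'rV[R]_d -> R)
    (x : 'rV[R]_d) : 'rV[R]_d :=
  \row_(i < d) 'D_(delta_mx 0 i) f x.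

Definition C1 (R : realType) (d : nat) (f : 'rV[R]_d -> R) : Prop :=
  (forall x : 'rV[R]_d, differentiable f x) /\ continuous (gradient f).

(* Main.v *)
Require Import Defs.
From mathcomp Require Import all_boot all_order all_algebra.
From mathcomp Require Import all_classical all_reals all_analysis.
From mathcomp Require Import lra ring.

Set Implicit Arguments.
Unset Strict Implicit.
Unset Printing Implicit Defensive.

Import Order.TTheory GRing.Theory Num.Theory.
Import numFieldNormedType.Exports.

Local Open Scope classical_set_scope.
Local Open Scope ring_scope.

(** Call [(p, q)] resonant when [omega p + omega q = omega (p + q)]. Subtracting
from [g] its linear part at the origin gives a function [h] that is still
additive on resonant pairs and satisfies [h 0 = 0] and ['d h 0 = 0], and the
claim becomes [h = c * omega].

Near a point [v <> 0] there are resonances [(v - p, p)] with [p] small. As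
[omega p = o(p)], they are tangent to the level set of [omega] at [v], and every
tangent direction occurs. Since [h p = o(p)] as well, the
differential of [h] at [v] vanishes on the kernel of the differential of
[omega] ([kernel_diff_of_resonance]). The two differentials are thus
proportional away from the origin, so [h] is locally constant on the level sets
of [omega] ([local_level_constancy]), and globally so since these are connected
([level_constancy]): [h = phi \o omega] for some [phi].

For [v <> 0] and every small [e > 0], connectedness of the level set [omega = e]
yields [p] with [omega p = e] and [omega (v - p) = omega v - e]
([exists_resonance]). Hence [phi (omega v) - phi (omega v - e) = phi e], and
dividing by [e] gives [phi' (omega v) = lim phi e / e] as [e] tends to [0]
([asymptotic_slope]). The right side does not depend on [v], so [phi'] is a
constant [c] and [h - c * omega] has zero differential
([proportional_of_resonance]).

The function [phi] is never constructed: its derivative at [omega v] is read as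
the ratio ['d h v u / 'd omega v u] for any [u] with ['d omega v u > 0], and all
curves are produced by the intermediate value theorem along lines. *)

(** * First-order expansions and motion along lines *)

Lemma diff_first_order (R : realType) (V : normedModType R) (f : V -> R) (x : V) (e : R) :
  differentiable f x -> 0 < e ->
  exists2 r : R, 0 < r & forall p : V, `|p| < r -> `|f (x + p) - f x - 'd f x p| <= e * `|p|.
Proof.
move=> df e0.
have := diff_locally df.
move/eqaddoP => /(_ _ e0) /=.
move=> /nbhs_normP[r /= r0 H]; exists r => // p pr.
have := H p; rewrite /ball_ /= sub0r normrN => /(_ pr).
have -> : f (x + p) - f x - 'd f x p = f (p + x) - (f x + 'd f x p).
  by rewrite (addrC x) opprD addrA.
exact.
Qed.

Lemma is_derive_line (R : realType) (V : normedModType R) (f : V -> R) (x p : V) (t : R) :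
  (forall z, differentiable f z) ->
  is_derive t 1 (fun s : R => f (x + s *: p)) ('d f (x + t *: p) p).
Proof.
move=> df.
have dl : is_diff t (fun s : R => x + s *: p) (fun s : R => s *: p).
  have h1 : is_diff t (fun s : R => s *: p) (fun s : R => s *: p).
    apply: DiffDef; first exact: differentiableZl.
    by rewrite diffZl // diff_val.
  have h2 : is_diff t (cst x) (0 : R -> V).
    by apply: DiffDef => //; rewrite diff_cst.
  have := is_diffD h2 h1.
  by move=> h; apply: (is_diff_eq h); rewrite add0r.
have dc : differentiable (f \o (fun s : R => x + s *: p)) t.
  by apply: differentiable_comp; first exact: ex_diff.
apply: DeriveDef; first exact: diff_derivable.
rewrite deriveE // diff_comp //=.
by rewrite diff_val /= scale1r.
Qed.

Lemma mvt_line (R : realType) (V : normedModType R) (f : V -> R) (x p : V) :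
  (forall z, differentiable f z) ->
  exists2 c : R, 0 <= c <= 1 & f (x + p) - f x = 'd f (x + c *: p) p.
Proof.
move=> df.
have d t := is_derive_line x p t df.
have [|c c01] := @MVT_segment R _ _ 0 1 ler01 (fun t _ => d t).
  apply: derivable_within_continuous => t _; exact: ex_derive.
by rewrite scale1r scale0r addr0 subr0 mulr1 => ->; exists c => //; rewrite in_itv in c01.
Qed.

Lemma ivt_line (R : realType) (V : normedModType R) (F : V -> R) (x p : V) (a b y : R) :
  continuous F -> a <= b -> F (x + a *: p) <= y <= F (x + b *: p) ->
  exists2 c : R, a <= c <= b & F (x + c *: p) = y.
Proof.
move=> cF ab /andP[ya yb].
have cl : continuous (fun t : R => F (x + t *: p)).
  move=> t; apply: (@continuous_comp _ _ _ (fun t : R => x + t *: p) F); last exact: cF.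
  apply: cvgD; first exact: cvg_cst.
  by apply: cvgZr_tmp => //; exact: cvg_id.
have [|c cab <-] := @IVT R _ a b y ab (continuous_subspaceT cl).
  by rewrite ge_min ya /= le_max yb orbT.
by exists c => //; rewrite in_itv in cab.
Qed.

(** * First-order consequence of resonances with a small wave *)

(** Every direction [w] tangent to the level set of [f] at [v] is the direction
of a small resonant increment: [s *: w] can be corrected by some [t *: u] with
[t = o(s)] so that [p = s *: w + t *: u] satisfies [f (v - p) + f p = f v],
because [f p] is of second order while [f (v - p)] moves transversally with
slope ['d f v u] in [t]. Dividing [h v - h (v - p) = h p] by [s] then gives
['d h v w = 0]. This is the Lagrange multiplier rule at the degenerate
resonance [(v, 0)], obtained by the intermediate value theorem. *)
Lemma kernel_diff_of_resonance (R : realType) (V : normedModType R) (f h : V -> R) (v u w : V) :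
  continuous f ->
  differentiable f v -> differentiable f 0 ->
  differentiable h v -> differentiable h 0 ->
  f 0 = 0 -> h 0 = 0 ->
  (forall p, 'd f 0 p = 0) -> (forall p, 'd h 0 p = 0) ->
  (forall p, f (v - p) + f p = f v -> h (v - p) + h p = h v) ->
  0 < 'd f v u -> 'd f v w = 0 -> 'd h v w = 0.
Proof.
move=> cf dfv df0 dhv dh0 f0 h0 df00 dh00 res k0 dfw.
set k := 'd f v u in k0.
(* [eta] bounds the slope [t / s] of the correction; let it tend to [0]. *)
suff main (eta : R) : 0 < eta <= 1 -> `|'d h v w| <= eta * (`|'d h v u| + 2).
  apply/eqP; rewrite -normr_le0 leNgt; apply/negP => hw0.
  set K := `|'d h v u| + 2 in main.
  have K0 : 0 < K by rewrite /K ltr_wpDl.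
  have e0 : 0 < Num.min 1 (`|'d h v w| / (2 * K)).
    by rewrite lt_min ltr01 divr_gt0 // mulr_gt0.
  have := main (Num.min 1 (`|'d h v w| / (2 * K))).
  rewrite e0 ge_min lexx /= => /(_ isT) H.
  have : `|'d h v w| <= (`|'d h v w| / (2 * K)) * K.
    apply: (le_trans H); apply: ler_wpM2r; first exact: ltW.
    by rewrite ge_min lexx orbT.
  have -> : `|'d h v w| / (2 * K) * K = `|'d h v w| / 2.
    by field; rewrite gt_eqF.
  by lra.
move=> /andP[eta0 eta1].
pose M := `|w| + `|u| + 1.
have M0 : 0 < M by rewrite /M ltr_wpDl // addr_ge0.
(* The two errors in [f] add up to at most [2 * eta * k' * s], which must stay
   below the displacement [eta * s * k] produced at [t = +- eta * s]; the bound
   [k' <= 1] serves the estimate on [h]. *)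
pose k' := Num.min 1 (k / 3).
have k'0 : 0 < k' by rewrite lt_min ltr01 divr_gt0.
have k'1 : k' <= 1 by rewrite ge_min lexx.
have k'k : k' <= k / 3 by rewrite ge_min lexx orbT.
pose e := eta * k' / M.
have e0 : 0 < e by rewrite /e divr_gt0 // mulr_gt0.
have [r1 r10 a1] := diff_first_order dfv e0.
have [r2 r20 a2] := diff_first_order df0 e0.
have [r3 r30 a3] := diff_first_order dhv e0.
have [r4 r40 a4] := diff_first_order dh0 e0.
pose r := Num.min (Num.min r1 r2) (Num.min r3 r4).
have r0 : 0 < r by rewrite !lt_min r10 r20 r30 r40.
have [s s0 sM] : exists2 s : R, 0 < s & s * M < r.
  exists (r / (2 * M)); first by rewrite divr_gt0 // mulr_gt0.
  have -> : r / (2 * M) * M = r / 2 by field; rewrite gt_eqF.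
  by lra.
pose p t := s *: w + t *: - u.
have pM (t : R) : `|t| <= eta * s -> `|p t| <= s * M.
  move=> ht; rewrite /p (le_trans (ler_normD _ _)) // !normrZ normrN (gtr0_norm s0).
  have : `|t| * `|u| <= s * `|u|.
    rewrite ler_wpM2r //; apply: (le_trans ht).
    by rewrite -[leRHS]mul1r ler_wpM2r // ltW.
  by rewrite /M !mulrDr mulr1; lra.
have eM t : `|t| <= eta * s -> e * `|p t| <= eta * k' * s.
  move=> /pM ht; have -> : eta * k' * s = e * (s * M).
    by rewrite /e; field; rewrite gt_eqF.
  by rewrite ler_wpM2l // ltW.
have pr t : `|t| <= eta * s -> `|p t| < r.
  by move=> /pM ht; exact: le_lt_trans sM.
have b1 t : `|t| <= eta * s -> `|f (v - p t) - f v - t * k| <= eta * k' * s.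
  move=> ht; have := a1 (- p t); rewrite normrN => /(_ _).
  have -> : 'd f v (- p t) = t * k.
    by rewrite /p scalerN opprB linearB !linearZ /= dfw oppr0 scaler0 addr0.
  move=> H; apply: le_trans (eM t ht); apply: H.
  by apply: (lt_le_trans (pr t ht)); rewrite !ge_min lexx.
have b2 t : `|t| <= eta * s -> `|f (p t)| <= eta * k' * s.
  move=> ht; have := a2 (p t); rewrite add0r f0 df00 !subr0.
  move=> H; apply: le_trans (eM t ht); apply: H.
  by apply: (lt_le_trans (pr t ht)); rewrite !ge_min lexx orbT.
have b3 t : `|t| <= eta * s ->
    `|h (v - p t) - h v - (t * 'd h v u - s * 'd h v w)| <= eta * k' * s.
  move=> ht; have := a3 (- p t); rewrite normrN => /(_ _).
  have -> : 'd h v (- p t) = t * 'd h v u - s * 'd h v w.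
    by rewrite /p scalerN opprB linearB !linearZ /= scalerN.
  move=> H; apply: le_trans (eM t ht); apply: H.
  by apply: (lt_le_trans (pr t ht)); rewrite !ge_min lexx !orbT.
have b4 t : `|t| <= eta * s -> `|h (p t)| <= eta * k' * s.
  move=> ht; have := a4 (p t); rewrite add0r h0 dh00 !subr0.
  move=> H; apply: le_trans (eM t ht); apply: H.
  by apply: (lt_le_trans (pr t ht)); rewrite !ge_min lexx !orbT.
have es0 : 0 < eta * s by rewrite mulr_gt0.
have esk0 : 0 < eta * s * k by rewrite mulr_gt0.
have ek's : eta * k' * s <= eta * s * (k / 3).
  by rewrite mulrAC ler_wpM2l // ltW.
have ek'1 : eta * k' * s <= eta * s.
  by rewrite mulrAC -[leRHS]mulr1 ler_wpM2l // ltW.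
pose F q := f (v - q) + f q.
have cF : continuous F.
  move=> q; apply: cvgD; last exact: cf.
  apply: (@continuous_comp _ _ _ (fun q => v - q) f); last exact: cf.
  by apply: cvgB; [exact: cvg_cst | exact: cvg_id].
have [||c /andP[c1 c2] Fc] := @ivt_line R V F (s *: w) (- u) (- (eta * s)) (eta * s) (f v) cF.
- by lra.
- rewrite /F -!/(p _); apply/andP; split.
    have ht : `|- (eta * s)| <= eta * s by rewrite normrN gtr0_norm.
    have := b1 _ ht; have := b2 _ ht; rewrite !ler_norml => /andP[_ B2] /andP[_ B1].
    by lra.
  have ht : `|eta * s| <= eta * s by rewrite gtr0_norm.
  have := b1 _ ht; have := b2 _ ht; rewrite !ler_norml => /andP[B2 _] /andP[B1 _].
  by lra.
have ht : `|c| <= eta * s by rewrite ler_norml c1 c2.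
have := res _ Fc; rewrite -/(p c) => hr.
have := b3 _ ht; have := b4 _ ht.
have -> : h (v - p c) = h v - h (p c) by rewrite -hr addrK.
move=> B4 B3.
have B : `|s * 'd h v w - c * 'd h v u| <= 2 * (eta * s).
  have -> : s * 'd h v w - c * 'd h v u =
      (h v - h (p c) - h v - (c * 'd h v u - s * 'd h v w)) + h (p c) by ring.
  by rewrite (le_trans (ler_normD _ _)) // (le_trans (lerD B3 B4)) // mulr_natl mulr2n lerD.
have B' : s * `|'d h v w| <= `|c| * `|'d h v u| + 2 * (eta * s).
  rewrite -[s in s * _](gtr0_norm s0) -!normrM.
  rewrite -[X in `|X|](subrK (c * 'd h v u)) (le_trans (ler_normD _ _)) // addrC.
  by rewrite lerD2l.
have B'' : s * `|'d h v w| <= s * (eta * (`|'d h v u| + 2)).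
  apply: (le_trans B'); have : `|c| * `|'d h v u| <= eta * s * `|'d h v u| by rewrite ler_wpM2r.
  by lra.
by rewrite ler_pM2l in B''.
Qed.

(** * Resonances of every small energy *)

Lemma connected_ivt (R : realType) (T : topologicalType) (A : set T) (F : T -> R) (p q : T) (y : R) :
  connected A -> continuous F -> A p -> A q -> F p <= y <= F q ->
  exists2 x, A x & F x = y.
Proof.
move=> cA cF Ap Aq yb.
have /connected_intervalP FA : connected (F @` A).
  by apply: connected_continuous_connected => //; exact: continuous_subspaceT.
have [x Ax Fx] := FA _ _ (imageP F Ap) (imageP F Aq) y yb.
by exists x.
Qed.

(** On the connected level set [f = e], the function [p |-> f (v - p)] is below
[f v - e] at a point of the ray through [u], where [f (v - p)] decreases at
first order whereas [e] is of second order, and above it at a point of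
the opposite ray. Hence it takes the value [f v - e]. *)
Lemma exists_resonance (R : realType) (V : normedModType R) (f : V -> R) (v u : V) :
  continuous f -> differentiable f v -> differentiable f 0 ->
  f 0 = 0 -> (forall p, 'd f 0 p = 0) -> (forall p, p <> 0 -> 0 < f p) ->
  (forall a, connected (f @^-1` [set a])) ->
  0 < 'd f v u ->
  exists2 delta : R, 0 < delta & forall e, 0 < e < delta ->
    exists2 p, f p = e & f (v - p) = f v - e.
Proof.
move=> cf dfv df0 f0 df00 fpos fconn.
set k := 'd f v u => k0.
have u0 : u <> 0 by move=> u0; move: k0; rewrite /k u0 linear0 ltxx.
have nu0 : 0 < `|u| by rewrite normr_gt0; exact/eqP.
have e0 : 0 < k / (3 * `|u|) by rewrite divr_gt0 // mulr_gt0.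
have [r1 r10 a1] := diff_first_order dfv e0.
have [r2 r20 a2] := diff_first_order df0 e0.
have [T T0 Tr] : exists2 T : R, 0 < T & T * `|u| < Num.min r1 r2.
  have m0 : 0 < Num.min r1 r2 by rewrite lt_min r10.
  move: (Num.min r1 r2) m0 => m m0.
  exists (m / (2 * `|u|)); first by rewrite divr_gt0 // mulr_gt0.
  have -> : m / (2 * `|u|) * `|u| = m / 2 by field; rewrite gt_eqF.
  by lra.
have small (t : R) : `|t| <= T ->
    `|f (v + t *: u) - f v - t * k| <= `|t| * k / 3 /\ `|f (t *: u)| <= `|t| * k / 3.
  move=> tT.
  have eE : k / (3 * `|u|) * `|t *: u| = `|t| * k / 3.
    by rewrite normrZ; field; rewrite gt_eqF.
  have tr : `|t *: u| < Num.min r1 r2.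
    by rewrite normrZ; apply: le_lt_trans Tr; rewrite ler_wpM2r.
  split.
    have := a1 (t *: u); rewrite linearZ -/k eE; apply.
    by apply: (lt_le_trans tr); rewrite ge_min lexx.
  have := a2 (t *: u); rewrite add0r f0 df00 !subr0 eE; apply.
  by apply: (lt_le_trans tr); rewrite ge_min lexx orbT.
have Tu (t : R) : t != 0 -> t *: u <> 0.
  by move=> t0 /eqP; rewrite scaler_eq0 (negbTE t0) /=; move=> /eqP.
(* Both rays reach every small energy, at a point within distance [T * `|u|]. *)
have level (t e : R) : `|t| = T -> 0 < e < f (t *: u) ->
    exists2 c : R, 0 < c <= 1 & f ((c * t) *: u) = e.
  move=> tT /andP[e_0 eT].
  have [|c /andP[c0 c1] fc] := @ivt_line R V f 0 (t *: u) 0 1 e cf ler01.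
    by rewrite scale0r addr0 f0 scale1r add0r !ltW.
  exists c; last by rewrite -scalerA -fc add0r.
  rewrite c1 andbT lt_neqAle c0 andbT; apply/eqP => c00.
  by move: fc e_0; rewrite -c00 scale0r addr0 f0 => <-; rewrite ltxx.
exists (Num.min (f (T *: u)) (f (- T *: u))).
  by rewrite lt_min !fpos //; apply: Tu; rewrite ?oppr_eq0 gt_eqF.
move=> e; rewrite lt_min => /and3P[e_0 eT eNT].
have [||c /andP[c0 c1] fc] := level T e; rewrite ?gtr0_norm ?e_0 //.
have [||c' /andP[c'0 c'1] fc'] := level (- T) e; rewrite ?normrN ?gtr0_norm ?e_0 //.
have cF : continuous (fun q => f (v - q)).
  move=> q; apply: (@continuous_comp _ _ _ (fun q => v - q) f); last exact: cf.
  by apply: cvgB; [exact: cvg_cst | exact: cvg_id].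
have [|p fp fvp] := @connected_ivt R V (f @^-1` [set e]) _ ((c * T) *: u)
  ((c' * - T) *: u) (f v - e) (fconn e) cF fc fc'; last by exists p.
have sg (b : R) : 0 < b -> b <= 1 -> 0 < b * T /\ `|b * T| <= T.
  by move=> d0 d1; rewrite gtr0_norm mulr_gt0 //; split => //; rewrite ler_piMl // ltW.
have [ct0 ctT] := sg c c0 c1; have [ct0' ctT'] := sg c' c'0 c'1.
have ctk : 0 < c * T * k by rewrite mulr_gt0.
have ctk' : 0 < c' * T * k by rewrite mulr_gt0.
have -> : - ((c' * - T) *: u) = (c' * T) *: u by rewrite mulrN scaleNr opprK.
rewrite -(scaleNr (c * T) u).
apply/andP; split.
  have [A1 _] := small (- (c * T)) (ltac:(by rewrite normrN)).
  have [_ A2] := small _ ctT.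
  move: A1 A2; rewrite fc normrN (gtr0_norm ct0) !ler_norml.
  move=> /andP[_ ?] /andP[_ ?]. lra.
have [A1 _] := small _ ctT'.
move: A1; rewrite (gtr0_norm ct0') !ler_norml.
by move=> /andP[? _]; lra.
Qed.

(** * Functions constant on level sets *)

Lemma linear_ker_proportional (R : realType) (V : normedModType R) (F H : {linear V -> R}) (u : V) :
  F u != 0 -> (forall w, F w = 0 -> H w = 0) ->
  forall w, H w = H u / F u * F w.
Proof.
move=> Fu ker w.
have Fw : F (w - (F w / F u) *: u) = 0.
  by rewrite linearB linearZ /= [X in _ - X]mulfVK // subrr.
have /eqP := ker _ Fw; rewrite linearB linearZ /= subr_eq0 => /eqP ->.
by rewrite [LHS]mulrC mulrA mulrAC.
Qed.

(** A step [p] from [P] that keeps [f] fixed has ['d f P p = o(`|p|)], hence also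
['d h P p = o(`|p|)] since the differentials are proportional at [P]. *)
Lemma level_set_increment_small (R : realType) (V : normedModType R) (f h : V -> R) (P : V) (l : R) :
  differentiable f P -> differentiable h P -> (forall w, 'd h P w = l * 'd f P w) ->
  forall e : R, 0 < e -> exists2 r : R, 0 < r &
    forall p, `|p| < r -> f (P + p) = f P -> `|h (P + p) - h P| <= e * `|p|.
Proof.
move=> df dh hl e e0.
have l1 : 0 < 1 + `|l| by rewrite ltr_wpDr.
have e'0 : 0 < e / (1 + `|l|) by rewrite divr_gt0.
have [r1 r10 a1] := diff_first_order df e'0.
have [r2 r20 a2] := diff_first_order dh e'0.
exists (Num.min r1 r2); first by rewrite lt_min r10.
move=> p; rewrite lt_min => /andP[/a1 + /a2] => A1 A2 fp.
rewrite fp subrr sub0r normrN in A1.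
rewrite -[X in `|X|](subrK ('d h P p)) (le_trans (ler_normD _ _)) //.
rewrite [in X in _ + X]hl normrM.
have -> : e * `|p| = e / (1 + `|l|) * `|p| + `|l| * (e / (1 + `|l|) * `|p|).
  by field; rewrite gt_eqF.
by rewrite lerD // ler_wpM2l.
Qed.

Lemma is_derive_0_of_small_increment (R : realType) (p : R -> R) (s : R) :
  (forall e : R, 0 < e -> exists2 r : R, 0 < r & forall t, `|t| < r ->
     `|p (s + t) - p s| <= e * `|t|) -> is_derive s 1 p 0.
Proof.
move=> H.
suff c : (fun t : R => t^-1 *: ((p \o shift s) (t *: 1) - p s)) @ 0^' --> (0 : R).
  apply: DeriveDef; first by apply/cvg_ex; exists 0.
  exact: cvg_lim.
apply/cvgrPdist_le => e e0.
have [r r0 Hr] := H e e0.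
near=> t.
have t0 : t != 0 by near: t; exact: nbhs_dnbhs_neq.
rewrite sub0r normrN /= normrZ normfV ler_pdivrMl ?normr_gt0 //.
rewrite [t *: 1]mulr1 (addrC t) (mulrC _ e); apply: Hr.
near: t; apply: dnbhs0_lt; exact: r0.
Unshelve. all: by end_near.
Qed.

(** In the slab where ['d f z u] stays above [k > 0], the level set of [f] is a
graph in the direction [u]: over the segment from [x] to [y] there is a unique
height [T s] putting [P s = x + s *: v + T s *: u] on the level set, and [T] is
Lipschitz at each point. So [h \o P] has zero derivative, and [P] joins [x] to
[y]. *)
Lemma local_level_constancy (R : realType) (V : normedModType R) (f h : V -> R) (x u : V) :
  (forall z, differentiable f z) -> (forall z, differentiable h z) ->
  {for x, continuous (fun z => 'd f z u)} ->
  0 < 'd f x u ->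
  (forall z w, 0 < 'd f z u -> 'd f z w = 0 -> 'd h z w = 0) ->
  exists2 r : R, 0 < r & forall y, `|y - x| < r -> f y = f x -> h y = h x.
Proof.
move=> df dh cdf dfx0 ker.
have u0 : u <> 0 by move=> u0; move: dfx0; rewrite u0 linear0 ltxx.
have nu0 : 0 < `|u| by rewrite normr_gt0; exact/eqP.
have [k k0 [rho rho0 ball]] : exists2 k : R, 0 < k & exists2 rho : R, 0 < rho &
    forall q, `|q| < rho -> k <= 'd f (x + q) u.
  exists ('d f x u / 2); first by rewrite divr_gt0.
  have := cdf; move=> /cvgrPdist_le /(_ ('d f x u / 2)).
  rewrite divr_gt0 // => /(_ isT) /nbhs_normP[r /= r0 H].
  exists r => // q qr; have := H (x + q).
  rewrite /ball_ /= opprD addrA subrr sub0r normrN => /(_ qr).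
  by rewrite ler_norml => /andP[_]; lra.
have [tau tau0 tauu] : exists2 tau : R, 0 < tau & tau * `|u| < rho / 2.
  exists (rho / 4 / `|u|); first by rewrite !divr_gt0.
  by rewrite divfK ?gt_eqF //; lra.
have mono (q : V) (t t' : R) : `|q| < rho / 2 -> `|t| <= tau -> `|t'| <= tau -> t' <= t ->
    k * (t - t') <= f (x + q + t *: u) - f (x + q + t' *: u).
  move=> qr; rewrite !ler_norml => /andP[t1 t2] /andP[t'1 t'2] tt.
  have [c /andP[c0 c1]] := mvt_line (x + q + t' *: u) ((t - t') *: u) df.
  have -> : x + q + t' *: u + (t - t') *: u = x + q + t *: u.
    by rewrite -addrA -scalerDl addrCA subrr addr0.
  move=> ->; rewrite linearZ /= mulrC; apply: ler_wpM2l; first by rewrite subr_ge0.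
  rewrite scalerA -2!addrA -scalerDl; apply: ball.
  rewrite (le_lt_trans (ler_normD _ _)) // normrZ.
  have : `|t' + c * (t - t')| * `|u| <= tau * `|u|.
    by rewrite ler_wpM2r // ler_norml; apply/andP; split; nra.
  by lra.
have [r1 r10 H1] : exists2 r1 : R, 0 < r1 & forall q, `|q| < r1 -> `|f (x + q) - f x| < k * tau.
  have := differentiable_continuous (df x) => /cvgrPdist_lt /(_ (k * tau)).
  rewrite mulr_gt0 // => /(_ isT) /nbhs_normP[r /= r0 H].
  exists r => // q qr; have := H (x + q).
  rewrite /ball_ /= opprD addrA subrr sub0r normrN => /(_ qr).
  by rewrite distrC.
exists (Num.min r1 (rho / 2) / 2).
  by rewrite divr_gt0 // lt_min r10 divr_gt0.
move=> y yr fy.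
pose v := y - x.
(* The parameter ranges over a neighbourhood of [0, 1], so that two-sided
   derivatives exist on the whole segment. *)
have sv (s : R) : -1 <= s <= 2 -> `|s *: v| < Num.min r1 (rho / 2).
  move=> s12; rewrite normrZ.
  have : `|s| * `|v| <= 2 * `|v|.
    rewrite ler_wpM2r // ler_norml; lra.
  by rewrite /v; lra.
have sv1 (s : R) : -1 <= s <= 2 -> `|s *: v| < rho / 2.
  by move=> /sv; rewrite lt_min => /andP[].
have cf : continuous f by move=> z; exact: differentiable_continuous.
have ntau : `|tau| <= tau by rewrite gtr0_norm.
have nNtau : `|- tau| <= tau by rewrite normrN gtr0_norm.
have [T HT] : exists T : R -> R, forall s, -1 <= s <= 2 ->
    `|T s| <= tau /\ f (x + s *: v + T s *: u) = f x.
  suff : forall s : R, exists t : R, -1 <= s <= 2 ->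
      `|t| <= tau /\ f (x + s *: v + t *: u) = f x.
    by move=> /choice[T HT]; exists T.
  move=> s; have [s12|] := boolP (-1 <= s <= 2); last by exists 0.
  have z : `|0 : R| <= tau by rewrite normr0 ltW.
  have M1 := mono (s *: v) tau 0 (sv1 _ s12) ntau z (ltW tau0).
  have M2 := mono (s *: v) 0 (- tau) (sv1 _ s12) z nNtau (ltac:(by rewrite oppr_le0 ltW)).
  have := H1 (s *: v); have := sv _ s12; rewrite lt_min => /andP[-> _] /(_ isT).
  rewrite ltr_norml => /andP[N1 N2].
  have [||c c12 fc] := @ivt_line R V f (x + s *: v) u (- tau) tau (f x) cf.
  - by lra.
  - by rewrite scale0r addr0 in M1 M2; lra.
  by exists c; rewrite ler_norml.
have Tuniq (s t : R) : -1 <= s <= 2 -> `|t| <= tau -> f (x + s *: v + t *: u) = f x -> T s = t.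
  move=> s12 tt ft; have [T1 T2] := HT _ s12.
  apply/eqP; rewrite eq_le; apply/andP; split; rewrite leNgt; apply/negP => lt.
    have := mono _ _ _ (sv1 _ s12) T1 tt (ltW lt).
    by rewrite T2 ft subrr; apply/negP; rewrite -ltNge mulr_gt0 // subr_gt0.
  have := mono _ _ _ (sv1 _ s12) tt T1 (ltW lt).
  by rewrite T2 ft subrr; apply/negP; rewrite -ltNge mulr_gt0 // subr_gt0.
pose P s := x + s *: v + T s *: u.
have P0 : P 0 = x.
  rewrite /P (Tuniq 0 0) ?scale0r ?addr0 ?normr0 //; lra.
have P1 : P 1 = y.
  rewrite /P (Tuniq 1 0) ?scale0r ?scale1r ?addr0 ?normr0 /v ?(addrC x) ?subrK //; lra.
have monoabs (q : V) (t t' : R) : `|q| < rho / 2 -> `|t| <= tau -> `|t'| <= tau ->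
    k * `|t - t'| <= `|f (x + q + t *: u) - f (x + q + t' *: u)|.
  move=> qr tt tt'; have [lt|/ltW lt] := leP t' t.
    by rewrite (ger0_norm (_ : 0 <= t - t')) ?subr_ge0 // (le_trans (mono _ _ _ qr tt tt' lt)) // ler_norm.
  rewrite distrC [leRHS]distrC (ger0_norm (_ : 0 <= t' - t)) ?subr_ge0 //.
  by rewrite (le_trans (mono _ _ _ qr tt' tt lt)) // ler_norm.
have dP (s : R) : -1 < s < 2 -> is_derive s 1 (h \o P) 0.
  move=> /andP[s1 s2]; apply: is_derive_0_of_small_increment => e e0.
  have s12 : -1 <= s <= 2 by rewrite !ltW.
  have [Ts1 Ts2] := HT _ s12.
  have dfu : 0 < 'd f (P s) u.
    apply: (lt_le_trans k0); rewrite /P -addrA; apply: ball.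
    rewrite (le_lt_trans (ler_normD _ _)) // [`|T s *: u|]normrZ.
    have := sv1 _ s12; have : `|T s| * `|u| <= tau * `|u| by rewrite ler_wpM2r.
    by move: tauu; lra.
  have hl := linear_ker_proportional (lt0r_neq0 dfu) (fun w => ker (P s) w dfu).
  pose C := (`|'d f (P s) v| + `|v|) / k.
  have C0 : 0 <= C by rewrite divr_ge0 ?addr_ge0 // ltW.
  pose D := `|v| + C * `|u| + 1.
  have D0 : 0 < D by rewrite ltr_wpDl // addr_ge0 // mulr_ge0.
  have v1 : 0 < `|v| + 1 by rewrite ltr_wpDl.
  have [rl rl0 L] := level_set_increment_small (df _) (dh _) hl (divr_gt0 e0 D0).
  have [ra ra0 A] := diff_first_order (df (P s)) (@ltr01 R).
  exists (Num.min (Num.min (s + 1) (2 - s)) (Num.min (ra / (`|v| + 1)) (rl / D))).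
    by rewrite !lt_min !divr_gt0 // !andbT -ltrBlDr sub0r s1 subr_gt0.
  move=> t; rewrite !lt_min => /andP[/andP[ts1 ts2] /andP[ta tl]].
  have st12 : -1 <= s + t <= 2.
    by move: ts1 ts2; rewrite !ltr_norml => /andP[? ?] /andP[? ?]; lra.
  have [Tt1 Tt2] := HT _ st12.
  (* At the old height [T s], shifting the base point by [t *: v] changes [f] by
     [O(t)]; returning to the level at rate at least [k] costs a height [O(t)]. *)
  have lip : `|T (s + t) - T s| <= C * `|t|.
    rewrite /C mulrAC ler_pdivlMr // mulrC.
    apply: (le_trans (monoabs _ _ _ (sv1 _ st12) Tt1 Ts1)).
    rewrite Tt2 -Ts2 -/(P s).
    have -> : x + (s + t) *: v + T s *: u = P s + t *: v.
      by rewrite /P scalerDl addrA [LHS]addrAC.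
    have := A (t *: v); rewrite mul1r normrZ => /(_ _) H.
    rewrite distrC -[X in `|X|](subrK ('d f (P s) (t *: v))).
    rewrite (le_trans (ler_normD _ _)) // linearZ /= normrM addrC mulrDl (mulrC `|t|) lerD2l.
    rewrite [leRHS]mulrC -linearZ; apply: H.
    rewrite ltr_pdivlMr // in ta; apply: le_lt_trans ta.
    by rewrite ler_wpM2l // lerDl.
  pose p := t *: v + (T (s + t) - T s) *: u.
  have Pst : P (s + t) = P s + p.
    rewrite /P /p scalerDl scalerBl -!addrA; congr (_ + (_ + _)).
    by rewrite addrCA [T s *: u + _]addrC subrK.
  have pD : `|p| <= D * `|t|.
    rewrite (le_trans (ler_normD _ _)) // !normrZ.
    have : `|T (s + t) - T s| * `|u| <= C * `|t| * `|u| by rewrite ler_wpM2r.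
    have := normr_ge0 t.
    by rewrite /D; lra.
  have := L p; rewrite -Pst {1 2}/P Tt2 Ts2 => /(_ _ erefl) H.
  apply: le_trans (_ : e / D * `|p| <= _).
    apply: H; apply: (le_lt_trans pD); by rewrite mulrC -ltr_pdivlMr.
  apply: (@le_trans _ _ (e / D * (D * `|t|))).
    by rewrite ler_wpM2l // divr_ge0 ?ltW.
  by rewrite mulrA divfK // gt_eqF.
have [||c c01] := @MVT_segment R (h \o P) (cst 0) 0 1 ler01.
- by move=> t; rewrite in_itv /= => t01; apply: dP; lra.
- apply: derivable_within_continuous => t; rewrite in_itv /= => t01.
  by apply: (@ex_derive _ _ _ _ _ _ 0); apply: dP; lra.
by rewrite /= mul0r => /eqP; rewrite subr_eq0 P0 P1 => /eqP.
Qed.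

(** The points of the level set where [h] takes the value [h x] form a relatively
closed set by continuity, and a relatively open one by local constancy. *)
Lemma level_constancy (R : realType) (V : normedModType R) (f h : V -> R) (x : V) :
  continuous h ->
  connected (f @^-1` [set f x]) ->
  (forall z, f z = f x -> exists2 r : R, 0 < r & forall y, `|y - z| < r -> f y = f z -> h y = h z) ->
  forall y, f y = f x -> h y = h x.
Proof.
move=> ch conn loc y fy.
pose B := f @^-1` [set f x] `&` h @^-1` [set h x].
suff -> : h y = h x :> R by [].
suff : B y by case.
rewrite (conn B) //.
- by exists x.
- pose I := [set zr : V * R | B zr.1 /\ 0 < zr.2 /\
     forall y, `|y - zr.1| < zr.2 -> f y = f zr.1 -> h y = h zr.1].
  exists (\bigcup_(i in I) ball i.1 i.2).
    by apply: bigcup_open => -[z r] [_ [r0 _]]; exact: ball_open.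
  apply/seteqP; split => z.
    move=> Bz; have [fz hz] := Bz; split => //.
    have [r r0 Hr] := loc z fz.
    by exists (z, r) => //; exact: ballxx.
  move=> [fz [[z' r] /= [[fz' hz'] [r0 Hr]] bz]]; split => //.
  rewrite /preimage /= -hz'; apply: Hr; last by rewrite fz fz'.
  by move: bz; rewrite -ball_normE /ball_ /= distrC.
- exists (h @^-1` [set h x]) => //.
  by apply: closed_comp => [z _|]; [exact: ch | exact: closed_eq].
Qed.

(** * The common slope *)

(** Writing [h = phi \o f], the resonances with a wave of small energy [e] say
[phi (f v) - phi (f v - e) = phi e]. The left side is [phi' (f v) * e + o(e)],
where [phi' (f v)] is the ratio of differentials below; so this ratio is the
limit of [phi e / e] at [0], whatever [v] is. *)
Lemma asymptotic_slope (R : realType) (V : normedModType R) (f h : V -> R) (v u : V) :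
  continuous f -> differentiable f v -> differentiable h v ->
  0 < 'd f v u ->
  (forall x y, f x = f y -> h x = h y) ->
  (forall p, f (v - p) + f p = f v -> h (v - p) + h p = h v) ->
  (exists2 delta : R, 0 < delta & forall e, 0 < e < delta ->
    exists2 p, f p = e & f (v - p) = f v - e) ->
  forall e : R, 0 < e -> exists2 delta : R, 0 < delta &
    forall q, 0 < f q < delta -> `|h q - 'd h v u / 'd f v u * f q| <= e * f q.
Proof.
move=> cf df dh; set k := 'd f v u => k0 lev res [d0 d00 Hd] e e0.
set m := 'd h v u / k.
have hm : 'd h v u = m * k by rewrite divfK // gt_eqF.
have u0 : u <> 0 by move=> u0; move: k0; rewrite /k u0 linear0 ltxx.
have nu0 : 0 < `|u| by rewrite normr_gt0; exact/eqP.
have m10 : 0 < 1 + `|m| by rewrite ltr_wpDr.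
(* The time [t] needed to lose the amount [f q] along [- u] is at most [2 * f q / k],
   whence the factor [2] in the second bound on [e2]. *)
have [e2 e20 [e2k e2e]] : exists2 e2 : R, 0 < e2 & e2 <= k / 2 /\ e2 <= e * k / (2 * (1 + `|m|)).
  exists (Num.min (k / 2) (e * k / (2 * (1 + `|m|)))).
    by rewrite lt_min !divr_gt0 // !mulr_gt0.
  by rewrite !ge_min !lexx orbT.
have [r1 r10 a1] := diff_first_order df (divr_gt0 e20 nu0).
have [r2 r20 a2] := diff_first_order dh (divr_gt0 e20 nu0).
have [T T0 [T1 T2]] : exists2 T : R, 0 < T & T * `|u| < r1 /\ T * `|u| < r2.
  have m0 : 0 < Num.min r1 r2 by rewrite lt_min r10.
  exists (Num.min r1 r2 / 2 / `|u|); first by rewrite !divr_gt0.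
  rewrite divfK ?gt_eqF //.
  have : Num.min r1 r2 <= r1 by rewrite ge_min lexx.
  have : Num.min r1 r2 <= r2 by rewrite ge_min lexx orbT.
  by move: (Num.min r1 r2) m0 => ?; lra.
have nut (t : R) : 0 <= t -> `|t *: - u| = t * `|u|.
  by move=> t0; rewrite normrZ normrN ger0_norm.
have dN (F : {linear V -> R}) (t : R) : F (t *: - u) = - (t * F u).
  by rewrite scalerN linearN linearZ.
have eE (t : R) : e2 / `|u| * (t * `|u|) = t * e2.
  by field; rewrite gt_eqF.
have b1 (t : R) : 0 <= t <= T -> `|f (v + t *: - u) - f v + t * k| <= t * e2.
  move=> /andP[t0 tT]; have := a1 (t *: - u).
  rewrite nut // dN -/k opprK eE; apply.
  by apply: le_lt_trans T1; rewrite ler_wpM2r.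
have b2 (t : R) : 0 <= t <= T -> `|h (v + t *: - u) - h v + t * (m * k)| <= t * e2.
  move=> /andP[t0 tT]; have := a2 (t *: - u).
  rewrite nut // dN hm opprK eE; apply.
  by apply: le_lt_trans T2; rewrite ler_wpM2r.
exists (Num.min d0 (T * k / 2)).
  by rewrite lt_min d00 divr_gt0 // mulr_gt0.
move=> q; rewrite lt_min => /and3P[q0 qd qT].
have [|p fp fvp] := Hd (f q); first by rewrite q0.
have [|||t /andP[t0 tT] ft] := @ivt_line R V (fun z => - f z) v (- u) 0 T (f q - f v).
- by move=> z; apply: cvgN; exact: cf.
- exact: ltW.
- rewrite scale0r addr0; have := b1 T; rewrite lexx (ltW T0) => /(_ isT).
  rewrite ler_norml => /andP[_ ?].
  have : T * e2 <= T * (k / 2) by rewrite ler_pM2l.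
  by lra.
have {}ft : f (v + t *: - u) = f v - f q by rewrite -[LHS]opprK ft opprB.
(* The resonant [p] may lie in an uncontrolled direction; replace [v - p] by the
   point of the same energy on the line through [v] along [u]. *)
have hq : h (v + t *: - u) - h v = - h q.
  rewrite -(lev p q fp) -(lev (v - p) _); last by rewrite fvp ft.
  by rewrite -(res p) ?fvp ?fp ?subrK // opprD addNKr.
have := b1 t; have := b2 t; rewrite t0 tT => /(_ isT) B2 /(_ isT) B1.
have fq : f v - f q - f v = - f q by ring.
move: B1 B2; rewrite hq ft fq => B1 B2.
have tk : t * (k / 2) <= f q.
  have : t * e2 <= t * (k / 2) by rewrite ler_wpM2l.
  by move: B1; rewrite ler_norml => /andP[_ B1']; lra.
have -> : h q - m * f q = - (- h q + t * (m * k)) + m * (- f q + t * k) by ring.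
rewrite (le_trans (ler_normD _ _)) // normrN normrM.
apply: (@le_trans _ _ ((1 + `|m|) * (t * e2))).
  by rewrite mulrDl mul1r lerD // ler_wpM2l.
apply: (@le_trans _ _ ((1 + `|m|) * (t * (e * k / (2 * (1 + `|m|)))))).
  by rewrite ler_pM2l // ler_wpM2l.
have -> : (1 + `|m|) * (t * (e * k / (2 * (1 + `|m|)))) = e * (t * (k / 2)).
  by field; rewrite gt_eqF.
by rewrite ler_pM2l.
Qed.

(** Differentials of [h] and [f] are proportional with a ratio equal, at every
nonzero point, to the slope of [h] against [f] near [0]. So [h - K *: f] has
zero differential. *)
Lemma proportional_of_resonance (R : realType) (V : normedModType R) (f h : V -> R) :
  (forall z, differentiable f z) -> (forall z, differentiable h z) ->
  f 0 = 0 -> h 0 = 0 ->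
  (forall p, 'd f 0 p = 0) -> (forall p, 'd h 0 p = 0) ->
  (forall p, p <> 0 -> 0 < f p) ->
  (forall a, connected (f @^-1` [set a])) ->
  (forall v, v <> 0 -> exists2 u, 0 < 'd f v u & {for v, continuous (fun z => 'd f z u)}) ->
  (forall p q, f p + f q = f (p + q) -> h p + h q = h (p + q)) ->
  exists c : R, forall v, h v = c * f v.
Proof.
move=> df dh f0 h0 df0 dh0 fpos fconn fu res.
have cf : continuous f by move=> z; exact: differentiable_continuous.
have ch : continuous h by move=> z; exact: differentiable_continuous.
have res' v p : f (v - p) + f p = f v -> h (v - p) + h p = h v.
  by have := res (v - p) p; rewrite subrK.
have ker v w : v <> 0 -> 'd f v w = 0 -> 'd h v w = 0.
  move=> v0 dw; have [u u0 _] := fu v v0.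
  exact: (kernel_diff_of_resonance cf _ _ _ _ f0 h0 df0 dh0 (res' v) u0 dw).
have lev x y : f x = f y -> h x = h y.
  move=> xy; apply: (@level_constancy R V f h y) => // z fz.
  have [z0|/eqP z0] := eqVneq z 0.
    exists 1 => // y' _; rewrite z0 f0 => fy'.
    have [->//|/eqP/fpos] := eqVneq y' 0.
    by rewrite fy' ltxx.
  have [u u0 cu] := fu z z0.
  apply: (@local_level_constancy R V f h z u) => // z' w dz'.
  by apply: ker => z'0; move: dz'; rewrite z'0 df0 ltxx.
have slope v u : 0 < 'd f v u -> forall e : R, 0 < e -> exists2 delta : R, 0 < delta &
    forall q, 0 < f q < delta -> `|h q - 'd h v u / 'd f v u * f q| <= e * f q.
  move=> u0; apply: asymptotic_slope => //; first exact: res'.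
  exact: exists_resonance u0.
have [[v0 v00]|all0] := pselect (exists v : V, v <> 0); last first.
  exists 0 => v; rewrite mul0r.
  by have [->//|/eqP v0] := eqVneq v 0; exfalso; apply: all0; exists v.
have [u0 du0 _] := fu v0 v00.
pose K := 'd h v0 u0 / 'd f v0 u0.
(* Points of arbitrarily small positive energy, at which slopes are compared. *)
have small (d : R) : 0 < d -> exists q, 0 < f q < d.
  move=> d0; have /cvgrPdist_lt /(_ _ d0) := cf 0.
  move=> /nbhs_normP[r /= r0 H].
  have nv0 : 0 < `|v0| by rewrite normr_gt0; exact/eqP.
  pose q := (r / 2 / `|v0|) *: v0.
  have q0 : q <> 0.
    move=> /eqP; rewrite scaler_eq0 => /orP[|/eqP//].
    by rewrite gt_eqF // !divr_gt0.
  exists q; rewrite fpos //=; have := H q; rewrite /ball_ /= sub0r normrN f0 sub0r normrN.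
  rewrite gtr0_norm ?fpos //; apply.
  by rewrite normrZ gtr0_norm ?divr_gt0 // divfK ?gt_eqF //; lra.
have slopeK v u : 0 < 'd f v u -> 'd h v u / 'd f v u = K.
  move=> du; apply/eqP; rewrite -subr_eq0 -normr_le0 leNgt; apply/negP => n0.
  set m := 'd h v u / 'd f v u in n0 *.
  have e0 : 0 < `|m - K| / 3 by rewrite divr_gt0.
  have [d1 d10 H1] := slope v u du _ e0.
  have [d2 d20 H2] := slope v0 u0 du0 _ e0.
  have [|q] := small (Num.min d1 d2); first by rewrite lt_min d10.
  rewrite lt_min => /and3P[q0 q1 q2].
  have := H1 q; have := H2 q; rewrite q0 q1 q2 -/m -/K => /(_ isT) A /(_ isT) B.
  have : `|m - K| * f q <= `|m - K| / 3 * f q + `|m - K| / 3 * f q.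
    rewrite -[X in _ * X <= _](gtr0_norm q0) -normrM.
    have -> : (m - K) * f q = (h q - K * f q) - (h q - m * f q) by ring.
    by rewrite (le_trans (ler_normB _ _)) // lerD.
  by rewrite -mulrDl ler_pM2r //; lra.
have dhK z w : 'd h z w = K * 'd f z w.
  have [->|/eqP z0] := eqVneq z 0; first by rewrite df0 dh0 mulr0.
  have [u du _] := fu z z0.
  by rewrite (linear_ker_proportional (lt0r_neq0 du) (fun w => @ker z w z0)) slopeK.
exists K => v.
have dG z : differentiable (h - K *: f) z.
  by apply: differentiableB => //; exact: differentiableZ.
have [c _] := mvt_line 0 v dG.
rewrite diffB //; last exact: differentiableZ.
rewrite diffZ // add0r !fctE /= f0 h0 dhK.
rewrite [X in _ = X - _]/(K * _) subrr scaler0 subr0 subr0 => /eqP.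
by rewrite subr_eq0 => /eqP.
Qed.

(** * Coordinates *)

Lemma diff_gradient (R : realType) (d : nat) (f : 'rV[R]_d -> R) (x p : 'rV[R]_d) :
  differentiable f x -> 'd f x p = dotprod (gradient f x) p.
Proof.
move=> df; rewrite {1}(row_sum_delta p) linear_sum; apply: eq_bigr => i _.
by rewrite linearZ /= mxE deriveE // [LHS]mulrC.
Qed.

(** A signed basis vector is preferred to the gradient itself, so that
['d f z u] is, up to a sign, one coordinate of the continuous gradient. *)
Lemma C1_increasing_direction (R : realType) (d : nat) (f : 'rV[R]_d -> R) (v : 'rV[R]_d) :
  C1 f -> gradient f v <> 0 ->
  exists2 u, 0 < 'd f v u & {for v, continuous (fun z => 'd f z u)}.
Proof.
move=> [df cg] /eqP/rV0Pn[i gi].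
exists (Num.sg (gradient f v 0 i) *: delta_mx 0 i).
  rewrite linearZ /= -deriveE //.
  have -> : 'D_(delta_mx 0 i) f v = gradient f v 0 i by rewrite mxE.
  by rewrite -[X in 0 < X]/(Num.sg _ * _) -normrEsg normr_gt0.
have -> : (fun z => 'd f z (Num.sg (gradient f v 0 i) *: delta_mx 0 i)) =
          (fun z => Num.sg (gradient f v 0 i) * gradient f z 0 i).
  by apply/funext => z; rewrite linearZ /= -deriveE // [gradient f z 0 i]mxE.
apply: (@continuousM _ _ (cst _) (fun z => gradient f z 0 i)); first exact: cst_continuous.
apply: (@continuous_comp _ _ _ (gradient f) (fun M : 'rV[R]_d => M 0 i)).
  exact: cg.
exact: coord_continuous.
Qed.

Theorem theorem1p5 (R : realType) (d : nat) (omega g : 'rV[R]_d -> R)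
    (hd : (2 <= d)%N)
    (omegaC1 : C1 omega)
    (omega0 : omega 0 = 0)
    (gradomega0 : gradient omega 0 = 0)
    (omega_gt0 : forall v : 'rV[R]_d, v <> 0 -> 0 < omega v)
    (gradomega_neq0 : forall v : 'rV[R]_d, v <> 0 -> gradient omega v <> 0)
    (omega_connected : forall a : R, connected (omega @^-1` [set a]))
    (gC1 : C1 g)
    (hg : forall v' v'' : 'rV[R]_d,
        omega v' + omega v'' = omega (v' + v'') ->
        g v' + g v'' = g (v' + v'')) :
  exists (b : 'rV[R]_d) (c : R),
    forall v : 'rV[R]_d, g v = dotprod b v + c * omega v.
Proof.
have [domega _] := omegaC1; have [dg _] := gC1.
have g0 : g 0 = 0.
  have := hg 0 0; rewrite !addr0 omega0 addr0 => /(_ erefl) /eqP.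
  by rewrite -subr_eq0 addrK => /eqP.
have cL : continuous ('d g 0) by exact: diff_continuous.
(* Subtracting the linear part of [g] at [0] preserves the resonance relation and
   puts [h] in the same position as [omega]: value and differential vanish at [0]. *)
pose h : 'rV[R]_d -> R := g - ('d g 0 : 'rV[R]_d -> R).
have dL z : differentiable ('d g 0 : 'rV[R]_d -> R) z by exact: linear_differentiable.
have dh z : differentiable h z by exact: differentiableB.
have dh0 p : 'd h 0 p = 0.
  by rewrite diffB // diff_lin // [LHS]subrr.
have domega0 p : 'd omega 0 p = 0.
  rewrite diff_gradient // gradomega0 /dotprod big1 // => i _.
  by rewrite mxE mul0r.
have hE v : h v = g v - 'd g 0 v by [].
have h0 : h 0 = 0 by rewrite hE g0 linear0 subr0.
have [c hc] : exists c : R, forall v, h v = c * omega v.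
  apply: proportional_of_resonance => //.
  - by move=> v /gradomega_neq0; exact: C1_increasing_direction.
  - by move=> p q /hg gpq; rewrite !hE -gpq linearD /=; ring.
exists (gradient g 0), c => v.
by rewrite -hc -diff_gradient // hE addrC subrK.
Qed.
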